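(* Let $\varphi:\mathbb{R}^n\to\mathbb{R}$ be upper-$\mathcal{C}^2$ on $\mathbb{R}^n$ with $\inf_{x\in\mathbb{R}^n}\varphi(x)>-\infty$, and consider the Nonmonotone Subgradient Method described in the context, with parameters $\tau_{\min}>0$, $\sigma,\beta\in{]0,1[}$. Suppose that: (a) there exists a constant $a>0$ such that $\langle w_k,d_k\rangle \leq -a \|d_k\|^2$ for all $k \in \mathbb{N}$; (b) for any bounded subsequence $(x_{k_j})_{j\in\mathbb{N}}$ generated by the method, there is a constant $b>0$ such that $\| w_{k_j}\| \leq b \| d_{k_j}\|$ for all $j \in \mathbb{N}$; (c) there exists an integer $m \geq 0$ such that $0\leq m_{k+1} \leq \min\{ m_{k }+1, m \}$ for all $k \in \mathbb{N}$. Then, for any initial point $x_0\in\mathbb{R}^n$, either the method stops at a stationary point after a finite number of iterations, or it produces a sequence $(x_{k})_{k\in\mathbb{N}}$ such that, if $\sup_{k\in\mathbb{N}}\tau_k<+\infty$, the following hold: (i) If $(x_{k_j})_{j\in\mathbb{N}}$ is a bounded subsequence of $(x_k)_{k\in\mathbb{N}}$, then $\inf_{j\in\mathbb{N}} \tau_{k_j} >0$; moreover $\lim_{j \to \infty } \|x_{k_{j}+1}-x_{k_j}\|= 0$, $\lim_{j \to \infty } \|w_{k_j}\| =0$, $\lim_{j \to \infty } \| d_{k_j}\| =0$ and $\lim_{j \to \infty} \varphi(x_{k_j}) = \lim_{k \to \infty} \varphi(x_{\ell( k)})$. (ii) If the entire sequence $(x_k)_{k\in\mathbb{N}}$ is bounded,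 then its set of accumulation points is nonempty, closed and connected, and there exists $c>0$ such that $$\min_{ 0 \leq j \leq k} \left\{ \| x_{j+1} - x_{j}\| + \| w_j\| + \| d_j\|\right\} \leq \frac{ c}{ \sqrt{ k+1}}\quad \text{for all } k \geq 0.$$ (iii) Any accumulation point of $(x_k)_{k\in\mathbb{N}}$ is a stationary point of $\varphi$. (iv) If $(x_k)_{k\in\mathbb{N}}$ is bounded and has an isolated accumulation point, then the entire sequence converges to a stationary point of $\varphi$.
   Context: Upper-$\mathcal{C}^2$: $\varphi$ is upper-$\mathcal{C}^2$ on $\mathbb{R}^n$ if on some neighborhood $V$ of each $\bar x$ there is a representation $\varphi(x)=\min_{c\in C}\varphi_c(x)$ with $C$ compact (in some topological space), each $\varphi_c$ of class $\mathcal{C}^2$ on $V$, and $\varphi_c$ and its first- and second-order partial derivatives continuous in $(x,c)\in V\times C$; such $\varphi$ is locally Lipschitz. $\partial\varphi$ is the Clarke subdifferential, and $\bar x$ is stationary if $0\in\partial\varphi(\bar x)$. For $a\in\mathbb{R}$, $[a]^+=\max\{a,0\}$. Nonmonotone Subgradient Method: given $x_0\in\mathbb{R}^n$, $\tau_{\min}>0$, $\sigma,\beta\in{]0,1[}$, for $k=0,1,\ldots$: (1) take $w_k\in\partial\varphi(x_k)$; if $w_k=0$, stop and return $x_k$. (2) Choose any $d_k\in\mathbb{R}^n\setminus\{0\}$ with $\langle w_k,d_k\rangle<0$. (3) Take any $\overline{\tau}_k\ge\tau_{\min}$, set $\tau_k:=\overline{\tau}_k$, and choose a memory parameter $m_k\in\mathbb{N}\cup\{0\}$.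 (4) While $\varphi(x_k+\tau_kd_k)>\max_{[k-m_k]^+\le i\le k}\varphi(x_i)+\sigma\tau_k\langle w_k,d_k\rangle$, set $\tau_k:=\beta\tau_k$. (5) Set $x_{k+1}:=x_k+\tau_kd_k$. Here $\tau_k$ denotes the final (accepted) stepsize. For each $k$, $\ell(k)$ denotes the smallest integer with $\ell(k)\in\operatorname{argmax}\{\varphi(x_i): [k-m_k]^+\le i\le k\}$. *)

(* Defs.v *)
From HB Require Import structures.
From mathcomp Require Import all_boot all_order all_algebra.
From mathcomp Require Import all_classical all_reals all_analysis.
Set Implicit Arguments. Unset Strict Implicit. Unset Printing Implicit Defensive.
Import Order.TTheory GRing.Theory Num.Theory.
Import numFieldNormedType.Exports.
Local Open Scope classical_set_scope.
Local Open Scope ring_scope.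

Section Defs.
Variables (R : realType) (n : nat).
Implicit Types (u v x y d w : 'rV[R]_n).

Definition dotp u v : R := \sum_(i < n) u 0 i * v 0 i.
Definition enorm u : R := Num.sqrt (dotp u u).

Definition evec (i : 'I_n) : 'rV[R]_n := delta_mx 0 i.

(* Clarke subdifferential: v \in \partial f(x) iff <v,d> <= f°(x;d) for all d,
   where f°(x;d) = limsup_{y -> x, t \downarrow 0} (f(y+td) - f(y))/t.
   The inequality "<v,d> <= limsup" is written out literally. *)
Definition clarke_subdiff (f : 'rV[R]_n -> R) x v : Prop :=
  forall d (eps delta : R), 0 < eps -> 0 < delta ->
    exists y (t : R), enorm (y - x) < delta /\ 0 < t /\ t < delta /\
      dotp v d - eps < (f (y + t *: d) - f y) / t.

Definition stationary (f : 'rV[R]_n -> R) x : Prop := clarke_subdiff f x 0.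

Definition upper_C2 (phi : 'rV[R]_n -> R) : Prop :=
  forall xbar, exists V : set 'rV[R]_n, open V /\ V xbar /\
  exists (T : topologicalType) (C : set T) (f : T -> 'rV[R]_n -> R),
    compact C /\
    (forall x, V x -> (exists c, C c /\ phi x = f c x) /\
                      (forall c, C c -> phi x <= f c x)) /\
    (forall c, C c -> forall x, V x -> forall i : 'I_n,
        derivable (f c) x (evec i) /\
        forall j : 'I_n, derivable ('D_(evec i) (f c)) x (evec j)) /\
    {within V `*` C, continuous (fun p : 'rV[R]_n * T => f p.2 p.1)} /\
    (forall i : 'I_n,
      {within V `*` C, continuous (fun p : 'rV[R]_n * T => 'D_(evec i) (f p.2) p.1)}) /\
    (forall i j : 'I_n,
      {within V `*` C, continuous
         (fun p : 'rV[R]_n * T => 'D_(evec j) ('D_(evec i) (f p.2)) p.1)}).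

Definition maxref (phi : 'rV[R]_n -> R) (x : nat -> 'rV[R]_n) (m : nat -> nat)
    (k : nat) : R :=
  \big[Num.max/phi (x k)]_((k - m k)%N <= i < k.+1) phi (x i).

Definition ell (phi : 'rV[R]_n -> R) (x : nat -> 'rV[R]_n) (m : nat -> nat)
    (k : nat) : nat :=
  let s := iota (k - m k) (k.+1 - (k - m k)) in
  nth k s (find (fun i => phi (x i) == maxref phi x m k) s).

Definition armijo (phi : 'rV[R]_n -> R) (refv sigma : R) x w d (t : R) : Prop :=
  phi (x + t *: d) <= refv + sigma * t * dotp w d.

(* (x,w,d,taubar,tau,m) is an infinite run (never stopping) of the
   Nonmonotone Subgradient Method; tau k is the accepted stepsize
   beta^i * taubar k with i the first index passing the test. *)
Definition nsm_run (phi : 'rV[R]_n -> R) (tau_min sigma beta : R)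
    (x w d : nat -> 'rV[R]_n) (taubar tau : nat -> R) (m : nat -> nat) : Prop :=
  forall k,
    clarke_subdiff phi (x k) (w k) /\ w k != 0 /\
    d k != 0 /\ dotp (w k) (d k) < 0 /\
    tau_min <= taubar k /\
    (exists i : nat,
       tau k = beta ^+ i * taubar k /\
       armijo phi (maxref phi x m k) sigma (x k) (w k) (d k) (beta ^+ i * taubar k) /\
       forall j : nat, (j < i)%N ->
         ~ armijo phi (maxref phi x m k) sigma (x k) (w k) (d k) (beta ^+ j * taubar k)) /\
    x k.+1 = x k + tau k *: d k.

Definition strictly_incr (kj : nat -> nat) : Prop := forall j, (kj j < kj j.+1)%N.

Definition bounded_seq (x : nat -> 'rV[R]_n) : Prop :=
  exists B : R, forall k, enorm (x k) <= B.

Definition acc_pt (x : nat -> 'rV[R]_n) (p : 'rV[R]_n) : Prop :=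
  exists kj, strictly_incr kj /\ (x \o kj) @ \oo --> p.

Definition isolated_acc_pt (x : nat -> 'rV[R]_n) (p : 'rV[R]_n) : Prop :=
  acc_pt x p /\ exists r : R, 0 < r /\
    forall q, acc_pt x q -> enorm (q - p) < r -> q = p.

End Defs.

(* Main.v *)
(* Near any point, phi minus a large multiple of |.|^2 is a minimum of concave functions, hence
   concave, so every Clarke subgradient w at x satisfies the descent inequality
   phi z <= phi x + <w, z - x> + K |z - x|^2, with K uniform on bounded sets by compactness.
   Applied at a rejected trial step it bounds the stepsizes below, and along the obtuse direction
   d_k it bounds the rise of phi from x_(k+1) back to x_k by the squared step length.  The
   reference values max phi(x_i) decrease to a limit L, and walking backwards from the maximizer
   of a later window shows phi(x_k) -> L along bounded subsequences, so the Armijo decrease forces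
   d_k -> 0.  Stationarity follows from closedness of the Clarke subdifferential, connectedness
   from Ostrowski's argument, and the rate from counting windows of length mm + 1.
   Estimates use the sup norm `|.|, which induces the topology of 'rV[R]_n; it is compared with
   the Euclidean enorm only at the interface. *)
Require Import Defs.
From HB Require Import structures.
From mathcomp Require Import all_boot all_order all_algebra.
From mathcomp Require Import all_classical all_reals all_analysis.
From mathcomp Require Import ring lra.
Set Implicit Arguments. Unset Strict Implicit. Unset Printing Implicit Defensive.
Import Order.TTheory GRing.Theory Num.Theory.
Import numFieldNormedType.Exports.
Local Open Scope classical_set_scope.
Local Open Scope ring_scope.

(** * The inner product, the sup norm and the Euclidean norm on row vectors *)

Section Norms.
Context {R : realType} {n : nat}.
Implicit Types u v w d x y z p : 'rV[R]_n.

Lemma coord_le_norm u i : `|u 0 i| <= `|u|.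
Proof.
have /mapP[j _ ->] : `|u 0 i| \in [seq `|u x.1 x.2| | x : 'I_1 * 'I_n].
  by apply/mapP; exists (ord0, i) => //=; rewrite mem_enum.
by rewrite [leRHS]/Num.Def.normr /= mx_normrE; apply/bigmax_geP; right => /=; exists j.
Qed.

Lemma norm_le_coord u (M : R) : 0 <= M -> (forall i, `|u 0 i| <= M) -> `|u| <= M.
Proof.
move=> M0 uM; rewrite [leLHS]/Num.Def.normr /= mx_normrE (bigmax_le _ M0)//= => -[i j] _ /=.
by rewrite ord1.
Qed.

Lemma dotp_le u v : `|dotp u v| <= n%:R * (`|u| * `|v|).
Proof.
rewrite /dotp (le_trans (ler_norm_sum _ _ _))//.
rewrite (@le_trans _ _ (\sum_(i < n) (`|u| * `|v|)))//.
  by apply: ler_sum => i _; rewrite normrM ler_pM// coord_le_norm.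
by rewrite sumr_const card_ord mulr_natl.
Qed.

Lemma dotpZr (t : R) u v : dotp u (t *: v) = t * dotp u v.
Proof. by rewrite /dotp mulr_sumr; apply: eq_bigr => i _; rewrite mxE mulrCA. Qed.

Lemma dotpNr u v : dotp u (- v) = - dotp u v.
Proof. by rewrite -scaleN1r dotpZr mulN1r. Qed.

Lemma dotpBl u v w : dotp (u - v) w = dotp u w - dotp v w.
Proof. by rewrite /dotp -sumrB; apply: eq_bigr => i _; rewrite !mxE mulrBl. Qed.

Lemma dotp_evec u i : dotp u (evec R i) = u 0 i.
Proof.
rewrite /dotp (bigD1 i)//= !mxE !eqxx mulr1 big1 ?addr0// => j ji.
by rewrite !mxE eqxx/= (negbTE ji) mulr0.
Qed.

Lemma norm_evec i : `|evec R i : 'rV[R]_n| <= 1.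
Proof.
apply: norm_le_coord => // j; rewrite !mxE eqxx/=.
by case: (j == i); rewrite ?normr1 ?normr0.
Qed.

Lemma dotp_ge0 u : 0 <= dotp u u.
Proof. by apply: sumr_ge0 => i _; rewrite -expr2 sqr_ge0. Qed.

Lemma enorm_sqr u : enorm u ^+ 2 = dotp u u.
Proof. by rewrite /enorm sqr_sqrtr// dotp_ge0. Qed.

Lemma enorm_ge0 u : 0 <= enorm u.
Proof. exact: sqrtr_ge0. Qed.

Lemma norm_le_enorm u : `|u| <= enorm u.
Proof.
apply: norm_le_coord => [|i]; first exact: enorm_ge0.
rewrite -sqrtr_sqr ler_sqrt ?dotp_ge0//.
rewrite /dotp (bigD1 i)//= -expr2 lerDl.
by apply: sumr_ge0 => j _; rewrite -expr2 sqr_ge0.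
Qed.

Lemma enorm_le_norm u : enorm u <= n%:R * `|u|.
Proof.
have h : 0 <= n%:R * `|u| by rewrite mulr_ge0.
rewrite -(@ler_pXn2r _ 2)// ?nnegrE ?enorm_ge0// enorm_sqr.
apply: le_trans (ler_norm _) _; apply: le_trans (dotp_le _ _) _.
rewrite exprMn -[X in _ * X <= _]expr2 ler_wpM2r ?sqr_ge0//.
by rewrite -natrX ler_nat; case: (n) => // k; rewrite -{1}[k.+1]muln1 leq_mul.
Qed.

Lemma enormZ (t : R) u : 0 <= t -> enorm (t *: u) = t * enorm u.
Proof.
move=> t0; rewrite /enorm.
have -> : dotp (t *: u) (t *: u) = t ^+ 2 * dotp u u.
  rewrite dotpZr /dotp !mulr_sumr; apply: eq_bigr => i _; rewrite !mxE; ring.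
by rewrite sqrtrM ?sqr_ge0// sqrtr_sqr ger0_norm.
Qed.

Lemma compact_norm_le (B : R) : compact [set u : 'rV[R]_n | `|u| <= B].
Proof.
apply: bounded_closed_compact.
  by exists B; split; [exact: num_real|move=> M BM u /= /le_trans; apply; exact: ltW].
have -> : [set u : 'rV[R]_n | `|u| <= B] = Num.norm @^-1` [set t | t <= B] by [].
by apply: preimage_closed; [move=> ? _; exact: norm_continuous|exact: closed_le].
Qed.

End Norms.

Arguments compact_norm_le {R} n B.

(** * Mean value theorem along axis-parallel paths and a second-order Taylor bound *)

Section CoordinatePath.
Context {R : realType} {n : nat}.
Implicit Types y z p : 'rV[R]_n.

Definition between (a b c : R) := (a <= c <= b) || (b <= c <= a).
(** A box replaces the segment from [y] to [z]: the information is about partial derivatives, so the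
    path from [y] to [z] runs parallel to the axes. *)
Definition inbox y z p := forall j, between (y 0 j) (z 0 j) (p 0 j).

Lemma betweenP (a b c : R) : between a b c ->
  a <= c /\ c <= b \/ b <= c /\ c <= a.
Proof. by case/orP => /andP; [left|right]. Qed.

Lemma between_l (a b : R) : between a b a.
Proof. by rewrite /between !lexx /= andbT le_total. Qed.

Lemma between_r (a b : R) : between a b b.
Proof. by rewrite /between !lexx /= andbT le_total. Qed.

Lemma between_trans (a b c e : R) : between a b c -> between a c e -> between a b e.
Proof.
move=> /betweenP h1 /betweenP h2; rewrite /between.
by case: h1 => -[? ?]; case: h2 => -[? ?]; apply/orP;
  [left|left|right|right]; apply/andP; split; lra.
Qed.

Lemma between_dist (a b c : R) : between a b c -> `|c - a| <= `|b - a|.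
Proof.
move=> /betweenP [[? ?]|[? ?]].
  by rewrite !ger0_norm; lra.
by rewrite !ler0_norm; lra.
Qed.

Lemma inbox_dist y z p : inbox y z p -> `|p - y| <= `|z - y|.
Proof.
move=> b; apply: norm_le_coord => // i.
apply: le_trans (coord_le_norm (z - y) i); rewrite !mxE.
exact: between_dist.
Qed.

(** Sup-norm balls are products of intervals, so they contain the box spanned by any two of their
    points; Euclidean balls do not. *)
Lemma inbox_ball (x : 'rV[R]_n) (r : R) y z p : inbox y z p ->
  `|y - x| < r -> `|z - x| < r -> `|p - x| < r.
Proof.
move=> b yr zr; apply: (@le_lt_trans _ _ (Num.max `|y - x| `|z - x|)); last first.
  by rewrite gt_max yr zr.
apply: norm_le_coord => [|i]; first by rewrite le_max normr_ge0.
have := coord_le_norm (y - x) i; have := coord_le_norm (z - x) i.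
have := b i; rewrite !mxE le_max => /betweenP b'.
rewrite !ler_norml => /andP[? ?] /andP[? ?].
by case: b' => -[? ?]; case: (leP (p 0 i) (x 0 i)) => ?; apply/orP;
  first [left; apply/andP; split; lra | right; apply/andP; split; lra].
Qed.

Lemma mvt_between (g : R -> R) (a b : R) :
  (forall s, between a b s -> derivable g s 1) ->
  exists xi, between a b xi /\ g b - g a = 'D_1 g xi * (b - a).
Proof.
move=> dg; case: (leP a b) => ab.
  have [||c cab e] := @MVT_segment R g (fun s => 'D_1 g s) a b ab.
  - move=> s; rewrite in_itv/= => /andP[s1 s2]; apply: derivableP; apply: dg.
    by rewrite /between (ltW s1) (ltW s2).
  - apply: derivable_within_continuous => s; rewrite in_itv/= => sab.
    by apply: dg; rewrite /between sab.
  by exists c; split=> //; rewrite /between; move: cab; rewrite in_itv/= => ->.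
have [||c cab e] := @MVT_segment R g (fun s => 'D_1 g s) b a (ltW ab).
- move=> s; rewrite in_itv/= => /andP[s1 s2]; apply: derivableP; apply: dg.
  by rewrite /between (ltW s1) (ltW s2) orbT.
- apply: derivable_within_continuous => s; rewrite in_itv/= => sab.
  by apply: dg; rewrite /between sab orbT.
exists c; split; first by rewrite /between; move: cab; rewrite in_itv/= => ->; rewrite orbT.
by rewrite -opprB e; ring.
Qed.

Lemma mvt_coord (g : 'rV[R]_n -> R) y i (b : R) :
  (forall s, between (y 0 i) b s ->
     derivable g (y + (s - y 0 i) *: evec R i) (evec R i)) ->
  exists xi, between (y 0 i) b xi /\
    g (y + (b - y 0 i) *: evec R i) - g y =
      'D_(evec R i) g (y + (xi - y 0 i) *: evec R i) * (b - y 0 i).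
Proof.
move=> dg; pose h (s : R) := g (y + (s - y 0 i) *: evec R i).
have quot s : (fun t : R => t^-1 *: ((h \o shift s) (t *: (1:R^o)) - h s)) =
   (fun t : R => t^-1 *: ((g \o shift (y + (s - y 0 i) *: evec R i)) (t *: evec R i)
       - g (y + (s - y 0 i) *: evec R i))).
  apply/funext => t; rewrite /h /=; congr (_ *: (g _ - _)).
  by rewrite addrCA -scalerDl [t *: _]mulr1 addrA.
have [|xi [bxi e]] := @mvt_between h (y 0 i) b.
  by move=> s /dg; rewrite /derivable quot.
exists xi; split=> //; move: e; rewrite /derive quot /h => <-.
by rewrite subrr scale0r addr0.
Qed.

Let path y z (k : nat) : 'rV[R]_n := \row_j (if (j < k)%N then z 0 j else y 0 j).

(** The increment telescopes along the staircase [path], which replaces the coordinates of [y] by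
    those of [z] one at a time; each leg is a one-variable mean value problem with its own
    intermediate point. *)
Lemma coord_path_mvt (g : 'rV[R]_n -> R) y z :
  (forall p i, inbox y z p -> derivable g p (evec R i)) ->
  exists xi : 'I_n -> 'rV[R]_n, (forall i, inbox y z (xi i)) /\
    g z - g y = \sum_(i < n) 'D_(evec R i) g (xi i) * (z 0 i - y 0 i).
Proof.
move=> dg.
have step (i : 'I_n) : exists xi, inbox y z xi /\
    g (path y z i.+1) - g (path y z i) = 'D_(evec R i) g xi * (z 0 i - y 0 i).
  have pi : path y z i 0 i = y 0 i by rewrite mxE ltnn.
  have inb s : between (y 0 i) (z 0 i) s ->
      inbox y z (path y z i + (s - path y z i 0 i) *: evec R i).
    move=> bs j; rewrite pi !mxE eqxx /=; case: (eqVneq j i) => [->|ji].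
      by rewrite ltnn mulr1 addrC subrK.
    by rewrite mulr0 addr0; case: ifP => _; [exact: between_r|exact: between_l].
  have [s|s [bs e]] := @mvt_coord g (path y z i) i (z 0 i).
    by rewrite {1}pi => /inb; apply: dg.
  exists (path y z i + (s - path y z i 0 i) *: evec R i).
  split; first by apply: inb; rewrite -{1}pi.
  rewrite -[in RHS]pi -{1}e; congr (g _ - _).
  apply/rowP => j; rewrite pi !mxE eqxx /= ltnS leq_eqVlt.
  case: (eqVneq j i) => [->|ji]; first by rewrite eqxx ltnn mulr1 addrC subrK.
  by rewrite (inj_eq val_inj) (negbTE ji) mulr0 addr0.
have [xi hxi] := choice step.
exists xi; split; first by move=> i; case: (hxi i).
rewrite -(eq_bigr _ (fun i _ => (hxi i).2)).
rewrite -(big_mkord xpredT (fun i => g (path y z i.+1) - g (path y z i))).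
rewrite telescope_sumr//; congr (g _ - g _).
  by apply/rowP => j; rewrite mxE ltn_ord.
by apply/rowP => j; rewrite mxE ltn0.
Qed.

(** The mean value formula is used twice: on [g], and on each partial derivative to move its
    intermediate point back to [y]. Each use sums over [n] coordinates, whence the factor
    [n ^ 2]. *)
Lemma taylor2_upper (g : 'rV[R]_n -> R) (M : R) y z :
  (forall p, inbox y z p -> forall i,
     derivable g p (evec R i) /\
     forall j, derivable ('D_(evec R i) g) p (evec R j)) ->
  (forall p, inbox y z p -> forall i j,
     `|'D_(evec R j) ('D_(evec R i) g) p| <= M) ->
  g z <= g y + dotp (\row_i 'D_(evec R i) g y) (z - y)
         + n%:R ^+ 2 * M * `|z - y| ^+ 2.
Proof.
move=> dg M2.
have [xi [bxi e]] : exists xi : 'I_n -> 'rV[R]_n, (forall i, inbox y z (xi i)) /\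
    g z - g y = \sum_(i < n) 'D_(evec R i) g (xi i) * (z 0 i - y 0 i).
  by apply: coord_path_mvt => p i /dg/(_ i)[].
have sub i p : inbox y (xi i) p -> inbox y z p.
  by move=> h j; apply: between_trans (h j); apply: bxi.
have grad i : `|'D_(evec R i) g (xi i) - 'D_(evec R i) g y| <= n%:R * M * `|z - y|.
  have [|ze [bze ->]] := @coord_path_mvt ('D_(evec R i) g) y (xi i).
    by move=> p j /sub/dg/(_ i)[_]; apply.
  apply: le_trans (ler_norm_sum _ _ _) _.
  apply: (@le_trans _ _ (\sum_(j < n) (M * `|z - y|))).
    apply: ler_sum => j _; rewrite normrM ler_pM// ?M2//; first exact: sub (bze j).
    apply: le_trans (inbox_dist (bxi i)).
    by apply: le_trans (coord_le_norm _ j); rewrite !mxE.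
  by rewrite sumr_const card_ord -[leLHS]mulr_natl mulrA.
have : \sum_(i < n) 'D_(evec R i) g (xi i) * (z 0 i - y 0 i) -
   dotp (\row_i 'D_(evec R i) g y) (z - y) <= \sum_(i < n) n%:R * M * `|z - y| * `|z - y|.
  rewrite /dotp -sumrB; apply: ler_sum => i _; rewrite !mxE -mulrBl.
  apply: le_trans (ler_norm _) _; rewrite normrM ler_pM//.
  by apply: le_trans (coord_le_norm _ i); rewrite !mxE.
rewrite -e sumr_const card_ord -[_ *+ n]mulr_natl => h.
have -> : n%:R ^+ 2 * M * `|z - y| ^+ 2 = n%:R * (n%:R * M * `|z - y| * `|z - y|) by ring.
lra.
Qed.

End CoordinatePath.

(** * Uniform local supergradients of upper-C2 functions *)

Section UpperC2.
Context {R : realType} {n : nat}.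
Implicit Types (x y z v w : 'rV[R]_n) (phi : 'rV[R]_n -> R).

Lemma within_prod_compact_bounded (X T : topologicalType) (V : set X) (C : set T)
    (g : X -> T -> R) (x0 : X) :
  open V -> V x0 -> compact C ->
  {within V `*` C, continuous (fun p : X * T => g p.1 p.2)} ->
  exists M : R, 0 <= M /\ \forall x \near x0, forall c, C c -> `|g x c| <= M.
Proof.
move=> oV Vx0 /compact_near_coveringP/near_covering_withinP cC /subspace_continuousP gc.
(* The bound is a second filter parameter tending to infinity, so one covering argument on [C]
   yields a neighbourhood and a bound together. *)
have := cC _ (filter_prod (nbhs x0) (pinfty_nbhs R))
  (fun i c => V i.1 -> `|g i.1 c| <= i.2) _.
case=> [c Cc|[A B] /= [Ax0 B0] AB].
  have /cvgrPdist_lt/(_ 1 ltr01) := gc (x0, c) (conj Vx0 Cc).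
  rewrite /= near_withinE => -[[U W] /= [Ux0 Wc] UW].
  exists (W, U `*` [set M | `|g x0 c| + 1 <= M]) => /=.
    split=> //; exists (U, [set M | `|g x0 c| + 1 <= M]) => //=; split=> //.
    exact: nbhs_pinfty_ge.
  move=> [c' [x M]] /= [Wc' [Ux hM]] Cc' Vx.
  have /= h := UW (x, c') (conj Ux Wc') (conj Vx Cc').
  have := ler_distD (g x0 c) (g x c') 0; rewrite subr0 distrC subr0; lra.
have [M [BM M0]] : exists M, B M /\ 0 <= M.
  near (pinfty_nbhs R) => M; exists M; split; near: M => //.
  by exists 0; split=> // M /ltW.
exists M; split=> //.
have nV : nbhs x0 V by exact: open_nbhs_nbhs.
near=> x => c Cc; apply: (AB (x, M)) => //=; last by near: x.
by split=> //=; near: x.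
Unshelve. all: by end_near. Qed.

(* The local supergradient [v] is the gradient at [y] of a function of the family active at [y]. *)
Lemma upper_C2_supergradient phi x0 : upper_C2 phi ->
  exists r K L : R, 0 < r /\ 0 <= K /\ 0 <= L /\
    forall y, `|y - x0| < r -> exists v, `|v| <= L /\
      forall z, `|z - x0| < r ->
        phi z <= phi y + dotp v (z - y) + K * `|z - y| ^+ 2.
Proof.
move=> /(_ x0) [V [oV [Vx0 [T [C [f [cC [phiE [df [_ [D1c D2c]]]]]]]]]]].
have h1 (i : 'I_n) : exists M : R, 0 <= M /\
    \forall x \near x0, forall c, C c -> `|'D_(evec R i) (f c) x| <= M.
  exact: within_prod_compact_bounded (D1c i).
have h2 (ij : 'I_n * 'I_n) : exists M : R, 0 <= M /\
    \forall x \near x0, forall c, C c ->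
      `|'D_(evec R ij.2) ('D_(evec R ij.1) (f c)) x| <= M.
  exact: (@within_prod_compact_bounded _ _ _ _
    (fun x c => 'D_(evec R ij.2) ('D_(evec R ij.1) (f c)) x) _ oV Vx0 cC (D2c _ _)).
have [M1 hM1] := choice h1; have [M2 hM2] := choice h2.
have M10 i : 0 <= M1 i by case: (hM1 i).
have M20 ij : 0 <= M2 ij by case: (hM2 ij).
have : \forall x \near x0, V x /\
   (forall i c, C c -> `|'D_(evec R i) (f c) x| <= M1 i) /\
   (forall ij c, C c -> `|'D_(evec R ij.2) ('D_(evec R ij.1) (f c)) x| <= M2 ij).
  apply: filterI; first exact: open_nbhs_nbhs.
  apply: filterI.
    exact: (filter_forall _ (fun i => (hM1 i).2)).
  exact: (filter_forall _ (fun i => (hM2 i).2)).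
move=> /nbhs_ballP [r /= r0]; rewrite -ball_normE => hr.
have {}hr y : `|y - x0| < r -> V y /\
   (forall i c, C c -> `|'D_(evec R i) (f c) y| <= M1 i) /\
   (forall ij c, C c -> `|'D_(evec R ij.2) ('D_(evec R ij.1) (f c)) y| <= M2 ij).
  by move=> yr; apply: hr; rewrite /= distrC.
(* The sums of these nonnegative bounds serve as bounds common to all indices. *)
pose K2 := \sum_ij M2 ij; pose L := \sum_i M1 i.
have leL i : M1 i <= L by rewrite /L (bigD1 i)//= lerDl sumr_ge0.
have leK ij : M2 ij <= K2 by rewrite /K2 (bigD1 ij)//= lerDl sumr_ge0.
have K20 : 0 <= K2 by exact: sumr_ge0.
have L0 : 0 <= L by exact: sumr_ge0.
exists r, (n%:R ^+ 2 * K2), L; do !split=> //; first by rewrite mulr_ge0// sqr_ge0.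
move=> y yr; have [Vy [D1y _]] := hr y yr.
have [[c [Cc phiy]] _] := phiE y Vy.
exists (\row_i 'D_(evec R i) (f c) y); split.
  by apply: norm_le_coord => // i; rewrite mxE (le_trans (D1y i c Cc)).
move=> z zr; have [Vz _] := hr z zr.
have [_ /(_ c Cc) phiz] := phiE z Vz.
rewrite (le_trans phiz)// phiy; apply: taylor2_upper => p pb.
  by have [Vp _] := hr p (inbox_ball pb yr zr); exact: df.
move=> i j; have [_ [_ /(_ (i, j) c Cc) h]] := hr p (inbox_ball pb yr zr).
exact: le_trans h (leK _).
Qed.

End UpperC2.

(** * The quadratic descent inequality for Clarke subgradients *)

Section ClarkeDescent.
Context {R : realType} {n : nat}.
Implicit Types (x y z v w : 'rV[R]_n) (phi : 'rV[R]_n -> R).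

(** Stated with a filter so that several smallness conditions can be imposed on one parameter. *)
Lemma near0_mul_lt (A e : R) : 0 < e -> \forall t \near 0^'+, t * A < e.
Proof.
move=> e0; have A1 : 0 < `|A| + 1 by rewrite ltr_wpDl.
near=> t; have t0 : 0 < t by near: t; exact: nbhs_right_gt.
have : t < e / (`|A| + 1) by near: t; apply: nbhs_right_lt; rewrite divr_gt0.
rewrite ltr_pdivlMr// => h; apply: le_lt_trans h; rewrite ler_pM2l//.
by have := ler_norm A; lra.
Unshelve. all: by end_near. Qed.

(* Slopes of a concave function along a line decrease, so the backward difference quotients in
   direction [z - x] appearing in the Clarke condition for [-(z - x)] control the forward ones. *)
Lemma clarke_descent_local phi x0 : upper_C2 phi ->
  exists r K : R, 0 < r /\ 0 <= K /\
    forall x w, `|x - x0| < r -> clarke_subdiff phi x w ->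
    forall z, `|z - x0| < r ->
      phi z <= phi x + dotp w (z - x) + K * `|z - x| ^+ 2.
Proof.
move=> /(upper_C2_supergradient x0)[r [K [L [r0 [K0 [L0 sup]]]]]].
(* A Lipschitz constant on the ball: the first term bounds the linear part, the second the quadratic
   part, since two points of the ball are within [2 * r]. *)
pose Lam := n%:R * L + K * (2 * r).
have lip a b : `|a - x0| < r -> `|b - x0| < r -> phi b <= phi a + Lam * `|b - a|.
  move=> ar br; have [v [vL /(_ b br)]] := sup a ar.
  have : dotp v (b - a) <= n%:R * L * `|b - a|.
    apply: le_trans (ler_norm _) _; apply: le_trans (dotp_le _ _) _.
    by rewrite -mulrA ler_wpM2l// ler_wpM2r.
  have ba : `|b - a| <= 2 * r.
    have := ler_distD x0 b a; rewrite [`|x0 - a|]distrC; lra.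
  have : K * `|b - a| ^+ 2 <= K * (2 * r) * `|b - a|.
    by rewrite expr2 [leLHS]mulrA ler_wpM2r// ler_wpM2l.
  rewrite /Lam; lra.
exists r, K; do 2!split=> //; move=> x w xr cw z zr.
apply/ler_addgt0Pr => eta eta0.
pose d := z - x.
near (0 : R)^'+ => delta.
have de0 : 0 < delta by near: delta; exact: nbhs_right_gt.
(* The first two conditions keep [y], [y - t *: d] and [y + d] in the ball; the third makes the
   accumulated errors smaller than [eta / 2]. *)
have de1 : delta * (1 + `|d|) < r - `|x - x0|.
  by near: delta; apply: near0_mul_lt; rewrite subr_gt0.
have de2 : delta * 1 < r - `|z - x0|.
  by near: delta; apply: near0_mul_lt; rewrite subr_gt0.
have de3 : delta * (K * `|d| ^+ 2 + 2 * Lam) < eta / 2.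
  by near: delta; apply: near0_mul_lt; lra.
have [y [t [yx [t0 [td]]]]] := cw (- d) (eta / 2) delta (ltac:(lra)) de0.
rewrite ltr_pdivlMr// dotpNr => cl.
have {}yx : `|y - x| < delta by apply: le_lt_trans (norm_le_enorm _) yx.
have dd : 0 <= delta * `|d| by rewrite mulr_ge0// ltW.
have tdd : t * `|d| <= delta * `|d| by rewrite ler_wpM2r// ltW.
have yr : `|y - x0| < r by have := ler_distD x y x0; lra.
have ydr : `|y + d - x0| < r.
  have -> : y + d - x0 = (z - x0) + (y - x) by apply/rowP => i; rewrite /d !mxE; ring.
  have := ler_normD (z - x0) (y - x); lra.
have ytr : `|y + t *: - d - x0| < r.
  have -> : y + t *: - d - x0 = (y - x0) + t *: - d by rewrite addrAC.
  have := ler_normD (y - x0) (t *: - d); rewrite normrZ normrN gtr0_norm//.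
  by have := ler_distD x y x0; lra.
(* One supergradient at [y] is tested at both ends: the short backward step bounds [dotp v d] above
   through [w], and the full forward step turns this into a bound on [phi (y + d)]. The Lipschitz
   estimate then replaces [y] by [x]. *)
have [v [_ sv]] := sup y yr.
have h1 := sv _ ydr; have h2 := sv _ ytr.
rewrite [y + d]addrC addrK in h1; rewrite [y + t *: - d]addrC addrK in h2.
rewrite dotpZr dotpNr normrZ normrN gtr0_norm// exprMn in h2.
have zE : z - (d + y) = x - y by apply/rowP => i; rewrite /d !mxE; ring.
have ydr' : `|d + y - x0| < r by rewrite [d + y]addrC.
have h3 := lip _ _ ydr' zr; rewrite zE distrC in h3.
have h4 := lip _ _ xr yr.
have Lam0 : 0 <= Lam by rewrite /Lam addr_ge0// !mulr_ge0// ltW.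
have h5 : Lam * `|y - x| <= Lam * delta by rewrite ler_wpM2l// ltW.
have h6 : dotp v d <= dotp w d + eta / 2 + t * (K * `|d| ^+ 2).
  rewrite -(ler_pM2l t0).
  rewrite [t *: - d + y]addrC in h2.
  lra.
have h7 : t * (K * `|d| ^+ 2) <= delta * (K * `|d| ^+ 2).
  by rewrite ler_wpM2r ?mulr_ge0 ?sqr_ge0// ltW.
rewrite -/d; lra.
Unshelve. all: by end_near. Qed.

(* A single [e] serves both as a radius and, inverted, as a curvature bound. *)
Lemma clarke_descent_bounded phi (B : R) : upper_C2 phi ->
  exists e : R, 0 < e /\
    forall x w, `|x| <= B -> clarke_subdiff phi x w ->
    forall z, `|z - x| < e ->
      phi z <= phi x + dotp w (z - x) + e^-1 * `|z - x| ^+ 2.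
Proof.
move=> u2.
have /compact_near_coveringP cB := compact_norm_le n B.
have := cB R 0^'+ (fun e x => forall w, clarke_subdiff phi x w ->
    forall z, `|z - x| < e ->
      phi z <= phi x + dotp w (z - x) + e^-1 * `|z - x| ^+ 2) _.
case=> [x0 _|U U0 UP].
  have [r [K [r0 [K0 des]]]] := clarke_descent_local x0 u2.
  near=> x e => w cw z ze.
  have e0 : 0 < e by near: e; exact: nbhs_right_gt.
  (* Halving the radius leaves room for [z] around [x]; the next condition makes [e^-1] dominate
     [K]. *)
  have er : e < r / 2 by near: e; apply: nbhs_right_lt; rewrite divr_gt0.
  have eK : e * K < 1 by near: e; exact: near0_mul_lt.
  have xr : `|x - x0| < r / 2.
    rewrite distrC; near: x; apply: cvgr_dist_lt; first exact: cvg_id.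
    by rewrite divr_gt0.
  have zr : `|z - x0| < r.
    apply: le_lt_trans (ler_distD x z x0) _.
    by rewrite [ltRHS]splitr ltrD// (lt_trans ze er).
  have xr' : `|x - x0| < r by clear -xr r0; lra.
  apply: le_trans (des x w xr' cw z zr) _.
  rewrite lerD2l ler_wpM2r ?sqr_ge0// -[leRHS]mul1r ler_pdivlMr//.
  by rewrite mulrC ltW.
have [e [e0 He]] := filter_ex (filterI (nbhs_right_gt (0 : R)) (ex_intro2 _ _ U U0 UP)).
by exists e; split=> // x w xB; exact: (He x xB).
Unshelve. all: by end_near. Qed.

End ClarkeDescent.

(** * Closedness of the Clarke subdifferential and termination of backtracking *)

Section LineSearch.
Context {R : realType} {n : nat}.
Implicit Types (x y z v w d : 'rV[R]_n) (phi : 'rV[R]_n -> R).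

(** A witness for [w j] at [x j], taken with smaller tolerances, is a witness for [v] at [p]: the
    base point and the pairing with [d] change little. *)
Lemma clarke_subdiff_closed phi (x w : nat -> 'rV[R]_n) p v :
  (forall j, clarke_subdiff phi (x j) (w j)) ->
  x @ \oo --> p -> w @ \oo --> v -> clarke_subdiff phi p v.
Proof.
move=> cw xp wv d eps delta eps0 delta0.
(* [N] dominates the norm comparison constant [n] and stays positive when [n = 0]. *)
have [N [N1 nN]] : exists N : R, 1 <= N /\ n%:R <= N.
  by exists n.+1%:R; rewrite ler1n ler_nat.
have N0 : 0 < N by lra.
have dN : 0 < delta / (2 * N) by rewrite divr_gt0 ?mulr_gt0.
have eN : 0 < eps / (2 * (N * (`|d| + 1))).
  by rewrite divr_gt0 ?mulr_gt0// ltr_wpDl.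
near \oo => j.
have xj : `|p - x j| < delta / (2 * N) by near: j; apply: cvgr_dist_lt; first exact: xp.
have wj : `|v - w j| < eps / (2 * (N * (`|d| + 1))).
  by near: j; apply: cvgr_dist_lt; first exact: wv.
have dN' : delta / (2 * N) <= delta / 2.
  by rewrite ler_pM2l// lef_pV2 ?posrE ?mulr_gt0// ler_peMr.
have [y [t [yx [t0 [td cl]]]]] := cw j d (eps / 2) (delta / (2 * N)) (divr_gt0 eps0 (ltr0n _ 2)) dN.
exists y, t; split.
  apply: le_lt_trans (enorm_le_norm _) _.
  have {}yx : `|y - x j| < delta / (2 * N) by apply: le_lt_trans (norm_le_enorm _) yx.
  have yp : `|y - p| < delta / N.
    have -> : delta / N = delta / (2 * N) + delta / (2 * N) by field; rewrite gt_eqF.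
    by apply: le_lt_trans (ler_distD (x j) _ _) _; rewrite ltrD// distrC.
  rewrite ltr_pdivlMr// mulrC in yp; apply: le_lt_trans yp.
  by rewrite ler_wpM2r.
split=> //; split.
  apply: lt_le_trans td (le_trans dN' _); lra.
apply: le_lt_trans cl.
have : dotp v d - dotp (w j) d <= eps / 2; last by lra.
rewrite -dotpBl; apply: le_trans (ler_norm _) _; apply: le_trans (dotp_le _ _) _.
apply: (@le_trans _ _ (N * (`|v - w j| * (`|d| + 1)))).
  by rewrite ler_pM// ?mulr_ge0// ler_wpM2l// lerDl.
move: wj; rewrite ltr_pdivlMr ?mulr_gt0 ?ltr_wpDl// => wj.
by move: (ltW wj); lra.
Unshelve. all: by end_near. Qed.

(** The descent inequality has slope [dotp w d], the test asks only for [sigma] times it; for short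
    steps the gap absorbs the quadratic term. *)
Lemma armijo_terminates phi (tau_min sigma beta : R) z w d (tb refv : R) :
  upper_C2 phi -> 0 < tau_min -> 0 < sigma < 1 -> 0 < beta < 1 ->
  clarke_subdiff phi z w -> dotp w d < 0 -> tau_min <= tb -> phi z <= refv ->
  exists i : nat, armijo phi refv sigma z w d (beta ^+ i * tb).
Proof.
move=> u2 tm0 /andP[s0 s1] /andP[b0 b1] cw wd tmb zr.
have [e [e0 des]] := clarke_descent_bounded `|z| u2.
have tb0 : 0 < tb by lra.
have /cvgrPdist_lt bi : (fun i => beta ^+ i) @ \oo --> (0 : R).
  by apply: cvg_expr; rewrite gtr0_norm.
(* [t] is a threshold for [beta ^+ i]: below it the trial point is within the radius [e] and the
   quadratic term is below the gap. *)
have [t [t0 [te tq]]] : exists t : R, 0 < t /\ t * (tb * `|d|) < e /\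
    t * (tb * (e^-1 * `|d| ^+ 2)) < - (1 - sigma) * dotp w d.
  have := @filter_ex _ (0^'+ : set_system R) _ _ (filterI (nbhs_right_gt (0 : R))
    (filterI (near0_mul_lt (tb * `|d|) e0)
      (@near0_mul_lt R (tb * (e^-1 * `|d| ^+ 2)) (- (1 - sigma) * dotp w d) _))).
  case=> [|t [/= ? [? ?]]]; last by exists t.
  by rewrite mulNr oppr_gt0 pmulr_rlt0// subr_gt0.
have [i _ /(_ i (leqnn _))] := bi _ t0.
rewrite /= sub0r normrN gtr0_norm ?exprn_gt0// => it.
exists i; rewrite /armijo; set s := beta ^+ i * tb.
have s0' : 0 < s by rewrite mulr_gt0// exprn_gt0.
have sd : `|z + s *: d - z| = s * `|d|.
  by rewrite addrC addKr normrZ gtr0_norm.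
have := des z w (lexx _) cw (z + s *: d).
rewrite sd [z + _ - z]addrC addKr dotpZr => h.
have : s * `|d| < e.
  by apply: le_lt_trans te; rewrite /s -mulrA ler_wpM2r ?(ltW it)// mulr_ge0// ltW.
move=> /h {}h; apply: le_trans h _.
have : s * (e^-1 * `|d| ^+ 2) <= - (1 - sigma) * dotp w d.
  apply: le_trans (ltW tq); rewrite /s -mulrA ler_wpM2r ?(ltW it)//.
  by rewrite !mulr_ge0 ?sqr_ge0// ltW// invr_gt0.
rewrite -(ler_pM2l s0') exprMn; lra.
Qed.

End LineSearch.

(** * Maxima over finite lists of indices *)

Section BigmaxSeq.
Context {R : realType}.

Lemma bigmax_seq_ge (s : seq nat) (F : nat -> R) (x0 : R) i :
  i \in s -> F i <= \big[Num.max/x0]_(j <- s) F j.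
Proof.
elim: s => // j s IH; rewrite inE big_cons le_max => /predU1P[->|/IH ->].
  by rewrite lexx.
by rewrite orbT.
Qed.

(** The starting value of the fold is itself a listed value, so the maximum is attained even when
    that value wins. *)
Lemma bigmax_seq_attained (s : seq nat) (F : nat -> R) (k : nat) :
  k \in s -> exists2 i, i \in s & \big[Num.max/F k]_(j <- s) F j = F i.
Proof.
move=> ks; suff [->|//] : \big[Num.max/F k]_(j <- s) F j = F k \/
    exists2 i, i \in s & \big[Num.max/F k]_(j <- s) F j = F i by exists k.
elim: {ks} s => [|j s IH]; first by left; rewrite big_nil.
rewrite big_cons; case: (leP (F j) (\big[Num.max/F k]_(j <- s) F j)) => _.
  case: IH => [->|[i si ->]]; [by left|right].
  by exists i => //; rewrite inE si orbT.
by right; exists j => //; rewrite inE eqxx.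
Qed.

End BigmaxSeq.

(** * The nonmonotone reference value *)

Section Maxref.
Context {R : realType} {n : nat} (phi : 'rV[R]_n -> R) (x : nat -> 'rV[R]_n) (m : nat -> nat).

Lemma maxref_ge k i : (k - m k <= i <= k)%N -> phi (x i) <= maxref phi x m k.
Proof.
move=> ik; apply: (bigmax_seq_ge (fun i => phi (x i))).
by rewrite mem_index_iota ltnS.
Qed.

Lemma maxref_attained k :
  exists2 i, (k - m k <= i <= k)%N & maxref phi x m k = phi (x i).
Proof.
have [|i] := @bigmax_seq_attained R (index_iota (k - m k) k.+1) (fun i => phi (x i)) k.
  by rewrite mem_index_iota ltnS leqnn leq_subr.
by rewrite mem_index_iota ltnS => ik e; exists i.
Qed.

(** The maximum is attained in the window, so the search defining [ell] succeeds and its default is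
    never returned. *)
Lemma phi_ell k : phi (x (ell phi x m k)) = maxref phi x m k.
Proof.
rewrite /ell; set s := iota _ _.
have hs : has (fun i => phi (x i) == maxref phi x m k) s.
  have [i ik e] := maxref_attained k; apply/hasP; exists i; last by rewrite e.
  have : i \in index_iota (k - m k) k.+1 by rewrite mem_index_iota ltnS.
  by [].
exact/eqP/(nth_find k hs).
Qed.

Lemma le_maxref k : phi (x k) <= maxref phi x m k.
Proof. by apply: maxref_ge; rewrite leqnn leq_subr. Qed.

End Maxref.

(** * Stepsizes, directions and function values along an infinite run *)

Section Run.
Context {R : realType} {n : nat} (phi : 'rV[R]_n -> R) (tau_min sigma beta : R).
Context (x w d : nat -> 'rV[R]_n) (taubar tau : nat -> R) (m : nat -> nat).
Hypothesis u2 : upper_C2 phi.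
Context (lb : R).
Hypothesis phi_lb : forall z, lb <= phi z.
Hypothesis tau_min_gt0 : 0 < tau_min.
Hypothesis sigma01 : 0 < sigma < 1.
Hypothesis beta01 : 0 < beta < 1.
Hypothesis run : nsm_run phi tau_min sigma beta x w d taubar tau m.
Context (a : R).
Hypothesis a_gt0 : 0 < a.
Hypothesis descent_dir : forall k, dotp (w k) (d k) <= - a * enorm (d k) ^+ 2.
Context (mm : nat).
Hypothesis memory : forall k, (m k.+1 <= minn (m k).+1 mm)%N.
Context (T : R).
Hypothesis tau_le : forall k, tau k <= T.

Let M := maxref phi x m.

Let s0 : 0 < sigma. Proof. by case/andP: sigma01. Qed.
Let s1 : sigma < 1. Proof. by case/andP: sigma01. Qed.
Let b0 : 0 < beta. Proof. by case/andP: beta01. Qed.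

Lemma run_clarke k : clarke_subdiff phi (x k) (w k).
Proof. by case: (run k). Qed.

Lemma run_dotp_lt0 k : dotp (w k) (d k) < 0.
Proof. by case: (run k) => _ [_ [_ []]]. Qed.

Lemma run_next k : x k.+1 = x k + tau k *: d k.
Proof. by case: (run k) => _ [_ [_ [_ [_ [_ ]]]]]. Qed.

Lemma run_enorm_gt0 k : 0 < enorm (d k).
Proof.
case: (run k) => _ [_ [d0 _]]; apply: lt_le_trans (norm_le_enorm _).
by rewrite normr_gt0.
Qed.

Lemma run_tau_gt0 k : 0 < tau k.
Proof.
case: (run k) => _ [_ [_ [_ [tb [[i [-> _]] _]]]]].
by rewrite mulr_gt0 ?exprn_gt0// (lt_le_trans tau_min_gt0).
Qed.

Lemma run_dist k : `|x k.+1 - x k| = tau k * `|d k|.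
Proof. by rewrite run_next addrC addKr normrZ gtr0_norm// run_tau_gt0. Qed.

Lemma run_armijo k :
  phi (x k.+1) <= M k + sigma * tau k * dotp (w k) (d k).
Proof.
rewrite run_next.
by case: (run k) => _ [_ [_ [_ [_ [[i [-> [ar _]]] _]]]]].
Qed.

(** The Armijo test combined with the angle condition on [d k]. *)
Lemma run_decrease k :
  sigma * a * (tau k * enorm (d k) ^+ 2) <= M k - phi (x k.+1).
Proof.
have h := run_armijo k.
have : sigma * tau k * dotp (w k) (d k) <= sigma * tau k * (- a * enorm (d k) ^+ 2).
  by rewrite ler_wpM2l ?descent_dir// mulr_ge0 ?(ltW s0) ?(ltW (run_tau_gt0 k)).
lra.
Qed.

Lemma phi_next_le k : phi (x k.+1) <= M k.
Proof.
have : 0 <= sigma * a * (tau k * enorm (d k) ^+ 2).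
  by rewrite !mulr_ge0 ?enorm_ge0 ?(ltW s0) ?(ltW a_gt0) ?(ltW (run_tau_gt0 k)).
by have := run_decrease k; lra.
Qed.

(** The memory grows by at most one per step. Hence a new window adds only the new iterate, which
    makes the reference values nonincreasing. *)
Lemma window_start k : (k - m k <= k.+1 - m k.+1)%N.
Proof.
have := memory k; rewrite leq_min => /andP[h _].
by rewrite -subSS leq_sub2l.
Qed.

Lemma maxref_next_le k : M k.+1 <= M k.
Proof.
have [i /andP[ik]] := maxref_attained phi x m k.+1.
rewrite /M leq_eqVlt => /predU1P[-> ->|]; first exact: phi_next_le.
rewrite ltnS => ki ->; apply: maxref_ge.
by rewrite ki (leq_trans (window_start k)).
Qed.

Lemma maxref_le j k : (j <= k)%N -> M k <= M j.
Proof.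
move=> jk; rewrite -(subnK jk); elim: (k - j)%N => [|i IH]; first by rewrite add0n.
by rewrite addSn (le_trans (maxref_next_le _)).
Qed.

Lemma phi_le_maxref0 k : phi (x k) <= M 0%N.
Proof. exact: le_trans (le_maxref _ _ _ _) (maxref_le (leq0n k)). Qed.

Lemma maxref_cvg : exists L : R, M @ \oo --> L /\ forall k, L <= M k.
Proof.
have ni : nonincreasing_seq M by move=> j k; exact: maxref_le.
have cM : cvgn M.
  apply: nonincreasing_is_cvgn => //; exists lb => _ [k _ <-].
  by apply: le_trans (phi_lb _) (le_maxref _ _ _ k).
exists (limn M); split=> // k; exact: nonincreasing_cvgn_ge.
Qed.

(** Subgradients are bounded where [|x k| <= B], because a large coordinate would push the descent
    inequality below [lb]; the angle condition then bounds [d k] by a multiple of the norm of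
    [w k]. *)
Lemma direction_bounded (B : R) :
  exists D : R, 0 < D /\ forall k, `|x k| <= B -> enorm (d k) <= D.
Proof.
have [e [e0 des]] := clarke_descent_bounded B u2.
pose s := e / 2; have s0' : 0 < s by rewrite /s; lra.
pose W := (M 0%N - lb + e^-1 * s ^+ 2) / s.
have W0 : 0 <= W.
  apply: divr_ge0; last exact: ltW.
  rewrite addr_ge0 ?mulr_ge0 ?sqr_ge0 ?invr_ge0 ?(ltW e0)// subr_ge0.
  exact: le_trans (phi_lb (x 0%N)) (phi_le_maxref0 _).
have wW k : `|x k| <= B -> `|w k| <= W.
  move=> kB; apply: norm_le_coord => // i.
  (* Moving against the sign of the coordinate makes the linear term equal to minus [s] times its
     absolute value. *)
  pose z := x k + (- (s * Num.sg (w k 0 i))) *: evec R i.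
  have zx : z - x k = (- (s * Num.sg (w k 0 i))) *: evec R i by rewrite /z addrC addKr.
  have nz : `|z - x k| <= s.
    rewrite zx normrZ normrN normrM (gtr0_norm s0') -mulrA ler_piMr//; first exact: ltW.
    rewrite mulr_ile1 ?norm_evec// normr_sg.
    by case: (w k 0 i != 0).
  have := des _ _ kB (run_clarke k) z.
  rewrite zx dotpZr dotp_evec -zx mulNr -mulrA -normrEsg => /(_ _)/le_trans h.
  rewrite ler_pdivlMr// mulrC.
  have {}h : phi z <= phi (x k) + - (s * `|w k 0 i|) + e^-1 * s ^+ 2.
    apply: h; first by apply: le_lt_trans nz _; rewrite /s; lra.
    by rewrite lerD2l ler_wpM2l ?invr_ge0 ?(ltW e0)// lerXn2r// nnegrE// ltW.
  have := phi_lb z; have := phi_le_maxref0 k; lra.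
exists (n%:R * W / a + 1); split.
  by apply: ltr_wpDl => //; apply: divr_ge0; [exact: mulr_ge0|exact: ltW].
move=> k kB; apply: (@le_trans _ _ (n%:R * W / a)); last by rewrite lerDl.
rewrite ler_pdivlMr// -(ler_pM2r (run_enorm_gt0 k)).
apply: (@le_trans _ _ (- dotp (w k) (d k))); first by have := descent_dir k; lra.
apply: le_trans (ler_norm _) _; rewrite normrN; apply: le_trans (dotp_le _ _) _.
rewrite mulrA ler_pM ?mulr_ge0 ?norm_le_enorm// ler_wpM2l//; exact: wW.
Qed.

(** Without backtracking the stepsize is at least [tau_min]. Otherwise the last rejected trial [s]
    either reaches [e / D], or lies in the range of the descent inequality, whose conflict with the
    failed test forces [s > (1 - sigma) * a * e]. *)
Lemma stepsize_bounded_below (B : R) :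
  exists c : R, 0 < c /\ forall k, `|x k| <= B -> c <= tau k.
Proof.
have [e [e0 des]] := clarke_descent_bounded B u2.
have [D [D0 dD]] := direction_bounded B.
pose c1 := (1 - sigma) * a * e.
have c10 : 0 < c1 by rewrite !mulr_gt0// subr_gt0.
have eD : 0 < e / D by rewrite divr_gt0.
exists (Num.min tau_min (beta * Num.min (e / D) c1)); split.
  by rewrite lt_min tau_min_gt0 mulr_gt0// lt_min eD.
move=> k kB.
case: (run k) => _ [_ [_ [wd [tb [[[|j] [-> [_ fail]]] _]]]]].
  by rewrite expr0 mul1r ge_min tb.
rewrite ge_min; apply/orP; right; rewrite exprS -mulrA ler_wpM2l ?(ltW b0)//.
have /negP := fail j (ltnSn j); rewrite -ltNge.
set s := beta ^+ j * taubar k => fj.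
have sg0 : 0 < s by rewrite mulr_gt0 ?exprn_gt0// (lt_le_trans tau_min_gt0).
rewrite ge_min; case: (leP (e / D) s) => //= sD.
have sx : x k + s *: d k - x k = s *: d k by rewrite addrC addKr.
have := des _ _ kB (run_clarke k) (x k + s *: d k).
rewrite sx dotpZr normrZ gtr0_norm// => /(_ _)/(lt_le_trans fj) h.
have {}h : M k + sigma * s * dotp (w k) (d k) <
    phi (x k) + s * dotp (w k) (d k) + e^-1 * (s * `|d k|) ^+ 2.
  apply: h; rewrite ltr_pdivlMr// in sD; apply: le_lt_trans sD.
  by rewrite ler_wpM2l ?(ltW sg0)// (le_trans (norm_le_enorm _))// dD.
have hM := le_maxref phi x m k; rewrite -/M in hM.
have dd := descent_dir k.
have nd : `|d k| ^+ 2 <= enorm (d k) ^+ 2.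
  by rewrite lerXn2r ?nnegrE ?enorm_ge0// norm_le_enorm.
have h2 : (1 - sigma) * - dotp (w k) (d k) < e^-1 * s * `|d k| ^+ 2.
  rewrite -(ltr_pM2l sg0); rewrite exprMn in h; lra.
have h3 : (1 - sigma) * (a * enorm (d k) ^+ 2) <= (1 - sigma) * - dotp (w k) (d k).
  by rewrite ler_wpM2l ?subr_ge0 ?(ltW s1)//; lra.
have h4 : e^-1 * s * `|d k| ^+ 2 <= e^-1 * s * enorm (d k) ^+ 2.
  by rewrite ler_wpM2l// mulr_ge0 ?invr_ge0 ?(ltW e0) ?(ltW sg0).
have E0 : 0 < enorm (d k) ^+ 2 by rewrite exprn_gt0// run_enorm_gt0.
have : (1 - sigma) * a < e^-1 * s by rewrite -(ltr_pM2r E0); lra.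
by rewrite [e^-1 * s]mulrC ltr_pdivlMr// => /ltW.
Qed.

(* Backward induction along the window: if the value at a later iterate is close to the limit
   of the reference values, the Armijo test forces the preceding step to be short, and since
   [w k] and [d k] make an obtuse angle, [phi] can have risen only quadratically in its length. *)
Lemma value_pullback (L : R) (N : nat) (B eps : R) : (forall k, L <= M k) -> 0 < eps ->
  exists eta : R, 0 < eta /\ forall k i, (i <= N)%N -> `|x k| <= B -> M k <= L + eta ->
    L - eta <= phi (x (k + i)%N) -> L - eps <= phi (x k).
Proof.
move=> LM; elim: N B eps => [|N IH] B eps eps0.
  exists eps; split=> // k i; rewrite leqn0 => /eqP -> _ _.
  by rewrite addn0.
have [e [e0 des]] := clarke_descent_bounded B u2.
have [D [D0 dD]] := direction_bounded B.
have T0 : 0 < T by apply: lt_le_trans (run_tau_gt0 0%N) (tau_le _).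
pose kap := T / (sigma * a).
have sa0 : 0 < sigma * a by rewrite mulr_gt0.
have kap0 : 0 < kap by rewrite divr_gt0.
(* The first demand keeps the step shorter than [e], the second keeps the error at [x k.+1] plus the
   rise back to [x k] below [eps]. *)
have [eta1 [eta10 [h1 h2]]] : exists eta : R, 0 < eta /\ eta * (2 * kap) < e ^+ 2 /\
    eta * (1 + e^-1 * (2 * kap)) < eps.
  have e20 : 0 < e ^+ 2 by rewrite exprn_gt0.
  have := @filter_ex _ (0^'+ : set_system R) _ _ (filterI (nbhs_right_gt (0 : R))
    (filterI (near0_mul_lt (2 * kap) e20) (near0_mul_lt (1 + e^-1 * (2 * kap)) eps0))).
  by case=> t [/= ? [? ?]]; exists t.
(* The ball is enlarged because [x k.+1] may leave the original one by at most [T * D]. *)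
have [eta2 [eta20 H]] := IH (B + T * D) eta1 eta10.
have [eta [eta0 [le1 [le2 le3]]]] : exists eta : R,
    0 < eta /\ eta <= eta1 /\ eta <= eta2 /\ eta <= eps.
  exists (Num.min eta1 (Num.min eta2 eps)); rewrite !lt_min eta10 eta20 eps0.
  by rewrite !ge_min !lexx !orbT.
exists eta; split=> // k [|i] iN kB Mk; first by rewrite addn0; lra.
rewrite -addSnnS => hi.
have dist : `|x k.+1 - x k| <= T * D.
  rewrite run_dist ler_pM// ?(ltW (run_tau_gt0 k))//.
  exact: le_trans (norm_le_enorm _) (dD k kB).
have next : L - eta1 <= phi (x k.+1).
  apply: (H k.+1 i) => //.
  - have := ler_distD (x k) (x k.+1) 0; rewrite !subr0; lra.
  - by have := maxref_next_le k; lra.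
  - lra.
(* The Armijo decrease is at most [M k - phi (x k.+1) <= 2 * eta1], and one factor [tau k] is
   bounded by [T]. *)
have dist2 : `|x k.+1 - x k| ^+ 2 <= eta1 * (2 * kap).
  rewrite run_dist exprMn expr2 -mulrA.
  apply: (@le_trans _ _ (T * (tau k * enorm (d k) ^+ 2))).
    have nd : `|d k| ^+ 2 <= enorm (d k) ^+ 2.
      by rewrite lerXn2r ?nnegrE ?enorm_ge0// norm_le_enorm.
    rewrite ler_pM ?(ltW (run_tau_gt0 k)) ?tau_le//.
      by rewrite mulr_ge0 ?sqr_ge0 ?(ltW (run_tau_gt0 k)).
    by rewrite ler_wpM2l ?(ltW (run_tau_gt0 k)).
  have -> : eta1 * (2 * kap) = T * (2 * eta1 / (sigma * a)).
    by rewrite /kap; field; rewrite !gt_eqF.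
  rewrite ler_pM2l// ler_pdivlMr// mulrC.
  by have := run_decrease k; lra.
have de : `|x k.+1 - x k| < e.
  by rewrite -(@ltr_pXn2r _ 2)// ?nnegrE ?(ltW e0)//; lra.
have := des _ _ kB (run_clarke k) _ de.
have xx : x k.+1 - x k = tau k *: d k by rewrite run_next addrC addKr.
rewrite {1}xx dotpZr.
have : tau k * dotp (w k) (d k) < 0 by rewrite pmulr_rlt0 ?run_tau_gt0 ?run_dotp_lt0.
have : e^-1 * `|x k.+1 - x k| ^+ 2 <= e^-1 * (eta1 * (2 * kap)).
  by rewrite ler_wpM2l// invr_ge0 ltW.
lra.
Qed.

Lemma next_bounded (B : R) : exists B' : R, forall k, `|x k| <= B -> `|x k.+1| <= B'.
Proof.
have [D [D0 dD]] := direction_bounded B; exists (B + T * D) => k kB.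
have : `|x k.+1 - x k| <= T * D.
  rewrite run_dist ler_pM// ?(ltW (run_tau_gt0 k))//.
  exact: le_trans (norm_le_enorm _) (dD k kB).
have := ler_distD (x k) (x k.+1) 0; rewrite !subr0; lra.
Qed.

(** From above [phi (x k)] is bounded by [M k]. From below, the maximizer of a window that starts at
    or after [k] has value at least [L], and [value_pullback] carries this back over at most [mm.+1]
    steps. *)
Lemma value_limit (L : R) (B eps : R) : M @ \oo --> L -> (forall k, L <= M k) -> 0 < eps ->
  \forall k \near \oo, `|x k| <= B -> `|phi (x k) - L| <= eps.
Proof.
move=> ML LM eps0.
have [eta [eta0 H]] := value_pullback mm.+1 B LM eps0.
near=> k => kB.
have Mk e : 0 < e -> `|L - M k| < e -> M k <= L + e.
  by move=> e0; rewrite distrC ltr_norml => /andP[_]; lra.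
have Mk1 : M k <= L + eta.
  by apply: Mk => //; near: k; apply: cvgr_dist_lt; first exact: ML.
have Mk2 : M k <= L + eps.
  by apply: Mk => //; near: k; apply: cvgr_dist_lt; first exact: ML.
have le1 := le_maxref phi x m k; rewrite -/M in le1.
(* The shift by [mm.+1] makes the index a successor, where the memory is known to be at most
   [mm]. *)
have [i /andP[ik ki] e] := maxref_attained phi x m (k + mm.+1).
have mk : (m (k + mm.+1) <= mm)%N.
  by rewrite addnS (leq_trans (memory _))// geq_minr.
have ki' : (k <= i)%N.
  apply: leq_trans ik; rewrite -[leqLHS](addnK mm.+1) leq_sub2l//.
  exact: leq_trans mk _.
have : L - eps <= phi (x k).
  apply: (H k (i - k)%N) => //.
    by rewrite leq_subLR.
  rewrite subnKC// -e; have := LM (k + mm.+1)%N; rewrite /M; lra.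
rewrite ler_norml; lra.
Unshelve. all: by end_near. Qed.

(** Both [M k] and [phi (x k.+1)] approach [L], so the decrease vanishes; the stepsize factor in it
    is bounded away from zero. *)
Lemma direction_cvg0 (B eps : R) : 0 < eps ->
  \forall k \near \oo, `|x k| <= B -> enorm (d k) <= eps.
Proof.
move=> eps0; have [L [ML LM]] := maxref_cvg.
have [c [c0 ctau]] := stepsize_bounded_below B.
have [B' BB'] := next_bounded B.
pose q := sigma * a * (c * eps ^+ 2) / 2.
have q0 : 0 < q by rewrite divr_gt0// !mulr_gt0// exprn_gt0.
have : \forall k \near \oo, `|x k.+1| <= B' -> `|phi (x k.+1) - L| <= q.
  have [N _ HN] := value_limit B' ML LM q0.
  by exists N => // k /= Nk; apply: HN => /=; exact: leq_trans Nk (leqnSn k).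
move=> near1; near=> k => kB.
have /(_ (BB' k kB)) : `|x k.+1| <= B' -> `|phi (x k.+1) - L| <= q by near: k.
rewrite ler_norml => /andP[lo _].
have : `|L - M k| < q by near: k; apply: cvgr_dist_lt; first exact: ML.
rewrite distrC ltr_norml => /andP[_ hi].
have h : sigma * a * (tau k * enorm (d k) ^+ 2) <= sigma * a * (c * eps ^+ 2).
  by apply: le_trans (run_decrease k) _; move: lo hi; rewrite /q; lra.
rewrite ler_pM2l ?mulr_gt0// in h.
have : c * enorm (d k) ^+ 2 <= c * eps ^+ 2.
  by apply: le_trans h; rewrite ler_wpM2r ?sqr_ge0// ctau.
by rewrite ler_pM2l// ler_pXn2r ?nnegrE ?enorm_ge0 ?(ltW eps0).
Unshelve. all: by end_near. Qed.

(** After [mm.+1] steps the window contains only iterates produced after [x j], each at least [s]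
    below a reference value not exceeding [M j]. *)
Lemma maxref_window_decrease (s : R) (j : nat) : 0 <= s ->
  (forall i, (j <= i < j + mm.+1)%N -> phi (x i.+1) <= M i - s) ->
  M (j + mm.+1)%N <= M j - s.
Proof.
move=> s_ge0 dec.
have [i /andP[ik ki] e] := maxref_attained phi x m (j + mm.+1).
rewrite {1}/M e.
have mk : (m (j + mm.+1) <= mm)%N.
  by rewrite addnS (leq_trans (memory _))// geq_minr.
have ji : (j < i)%N.
  by apply: leq_trans ik; rewrite -[leqLHS](addnK mm) addSnnS leq_sub2l.
case: i ji ki {ik e} => // i ji ki; apply: le_trans (dec i _) _; first by apply/andP.
by rewrite lerD2r maxref_le.
Qed.

(** Each full block of [mm.+1] steps lowers the reference value by [s * q], and the total drop is at
    most [M 0 - lb]; the summand [E] pays for the incomplete last block. A free lower bound [q] lets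
    a minimum of residuals be inserted later. *)
Lemma direction_rate (c : R) : 0 < c -> (forall k, c <= tau k) ->
  exists C : R, 0 < C /\ forall (k : nat) (q : R), 0 <= q ->
    (forall j, (j <= k)%N -> q <= enorm (d j) ^+ 2) -> q * k.+1%:R <= C.
Proof.
move=> c0 ctau.
pose A := M 0%N - lb; pose s := sigma * a * c.
have A0 : 0 <= A by rewrite subr_ge0 (le_trans (phi_lb (x 0%N)))// le_maxref.
have sc0 : 0 < s by rewrite !mulr_gt0.
pose E := enorm (d 0%N) ^+ 2; have E0 : 0 < E by rewrite exprn_gt0// run_enorm_gt0.
exists (mm.+1%:R * (A / s + E)); split.
  by rewrite mulr_gt0// ltr_wpDl// divr_ge0// ltW.
move=> k q q0 hq.
have dec i : (i <= k)%N -> phi (x i.+1) <= M i - s * q.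
  move=> ik; have := run_decrease i.
  have : s * q <= sigma * a * (tau i * enorm (d i) ^+ 2).
    rewrite /s -mulrA ler_pM2l ?mulr_gt0// ler_pM ?(ltW c0) ?ctau// hq//.
  lra.
have win i : (i * mm.+1 <= k.+1)%N -> M (i * mm.+1)%N <= M 0%N - i%:R * (s * q).
  elim: i => [_|i IH]; first by rewrite mul0n mul0r subr0.
  rewrite mulSn addnC => ik.
  apply: le_trans (maxref_window_decrease (s := s * q) _ _) _.
  - by rewrite mulr_ge0// ltW.
  - by move=> j /andP[_ j2]; apply: dec; rewrite -ltnS (leq_trans j2).
  - have := IH (leq_trans (leq_addr _ _) ik); rewrite -natr1; lra.
pose i := (k.+1 %/ mm.+1)%N.
have : i%:R * q <= A / s.
  rewrite ler_pdivlMr//.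
  have := win i (leq_trunc_div _ _); have := le_maxref phi x m (i * mm.+1).
  have := phi_lb (x (i * mm.+1)%N); rewrite /A /M; lra.
have qE : q <= E by exact: hq.
have ki : k.+1%:R <= mm.+1%:R * (i%:R + 1) :> R.
  by rewrite natr1 -natrM ler_nat mulnC ltnW// ltn_ceil.
move=> iq; apply: (@le_trans _ _ (q * (mm.+1%:R * (i%:R + 1)))).
  by rewrite ler_wpM2l.
rewrite mulrCA ler_wpM2l//; lra.
Qed.

End Run.

(** * Accumulation points of bounded sequences *)

Section AccumulationPoints.
Context {R : realType} {n : nat}.
Implicit Types (x : nat -> 'rV[R]_n) (p q : 'rV[R]_n).

Lemma strictly_incr_ge (kj : nat -> nat) j : strictly_incr kj -> (j <= kj j)%N.
Proof. by move=> h; elim: j => // j IH; exact: leq_ltn_trans IH (h j). Qed.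

Lemma near_subseq (kj : nat -> nat) (P : nat -> Prop) : strictly_incr kj ->
  (\forall k \near \oo, P k) -> \forall j \near \oo, P (kj j).
Proof.
move=> h [N _ HN]; exists N => // j /= Nj; apply: HN => /=.
exact: leq_trans Nj (strictly_incr_ge j h).
Qed.

Lemma acc_ptP x p : acc_pt x p <->
  forall (e : R) (N : nat), 0 < e -> exists2 k, (N <= k)%N & `|x k - p| < e.
Proof.
split=> [[kj [kji xp]] e N e0|fr].
  near \oo => j; exists (kj j).
    apply: leq_trans (strictly_incr_ge j kji).
    by near: j; exact: nbhs_infty_ge.
  by rewrite distrC; near: j; apply: cvgr_dist_lt; first exact: xp.
have /choice[g gP] : forall jN : nat * nat,
    exists k, (jN.2 <= k)%N /\ `|x k - p| < jN.1.+1%:R^-1.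
  by move=> [j N]; have [//|k Nk xk] := fr (j.+1%:R^-1) N _; exists k.
(* Asking for an index at least one past the previous one makes the choice strictly increasing. *)
pose kj := fix F j := if j is j'.+1 then g (j, (F j').+1) else g (0%N, 0%N).
exists kj; split.
  by move=> j; rewrite /=; case: (gP (j.+1, (kj j).+1)).
have kjP j : `|x (kj j) - p| < j.+1%:R^-1.
  by case: j => [|j]; [case: (gP (0%N, 0%N))|case: (gP (j.+1, (kj j).+1))].
apply/cvgrPdist_lt => e e0; near=> j.
rewrite /= distrC; apply: lt_le_trans (kjP j) _.
near: j; have [N _ HN] := near_infty_natSinv_lt (PosNum e0).
by exists N => // j /HN/ltW.
Unshelve. all: by end_near. Qed.

(** Bolzano-Weierstrass along the indices satisfying [P], in a form suited to proofs by
    contradiction. *)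
Lemma bounded_frequently_cluster x (P : nat -> Prop) (B : R) :
  (forall N, exists2 k, (N <= k)%N & P k) -> (forall k, P k -> `|x k| <= B) ->
  exists p, forall (e : R) (N : nat), 0 < e ->
    exists k, (N <= k)%N /\ P k /\ `|x k - p| < e.
Proof.
move=> fr PB.
have /choice[g gP] : forall N, exists k, (N <= k)%N /\ P k.
  by move=> N; have [k ? ?] := fr N; exists k.
have [|p [_ clp]] := compact_norm_le n B ((x \o g) @ \oo) _.
  by exists 0%N => // j _ /=; apply: PB; case: (gP j).
exists p => e N e0.
have tail : ((x \o g) @ \oo) [set x (g j) | j in [set j | (N <= j)%N]].
  by exists N => // j /= Nj; exists j.
have [y [[j Nj <-]]] := clp _ _ tail (nbhsx_ballx p e e0).
rewrite -ball_normE /= distrC => xp.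
exists (g j); split; first by case: (gP j) => + _; exact: leq_trans.
by split=> //; case: (gP j).
Qed.

Lemma closed_acc_pt x : closed (acc_pt x).
Proof.
move=> p clp; apply/acc_ptP => e N e0.
have [q [/acc_ptP xq]] := clp _ (nbhsx_ballx p (e / 2) (divr_gt0 e0 (ltr0n _ 2))).
rewrite -ball_normE /= => pq.
have [k Nk xk] := xq (e / 2) N (divr_gt0 e0 (ltr0n _ 2)).
exists k => //; apply: le_lt_trans (ler_distD q _ _) _.
by rewrite [ltRHS]splitr ltrD// distrC.
Qed.

(** Otherwise the indices far from all accumulation points would cluster at a point, which is itself
    an accumulation point. *)
Lemma bounded_near_acc_pt x (B e : R) : (forall k, `|x k| <= B) -> 0 < e ->
  \forall k \near \oo, exists2 q, acc_pt x q & `|x k - q| < e.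
Proof.
move=> xB e0; apply: contrapT => nn.
have [||p hp] := @bounded_frequently_cluster x
    (fun k => ~ exists2 q, acc_pt x q & `|x k - q| < e) B.
- move=> N; apply: contrapT => h; apply: nn; exists N => // k /= Nk.
  by apply: contrapT => h2; apply: h; exists k.
- by move=> k _; exact: xB.
have [k [_ [nk xk]]] := hp e 0%N e0; apply: nk; exists p => //.
apply/acc_ptP => e' N e'0; have [k' [? [_ ?]]] := hp e' N e'0.
by exists k'.
Qed.

Lemma bounded_acc_pt_ex x (B : R) : (forall k, `|x k| <= B) -> exists p, acc_pt x p.
Proof.
move=> xB; have [k [q xq _]] := filter_ex (bounded_near_acc_pt xB ltr01).
by exists q.
Qed.

(* Ostrowski: with vanishing steps the sequence cannot jump the gap that would separate two
   relatively clopen pieces of the compact set of accumulation points. *)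
Lemma connected_acc_pt x (B : R) : (forall k, `|x k| <= B) ->
  (forall e : R, 0 < e -> \forall k \near \oo, `|x k.+1 - x k| < e) ->
  connected (acc_pt x).
Proof.
move=> xB steps S [b Sb] [V oV SV] [C cC SC].
have accB p : acc_pt x p -> `|p| <= B.
  move=> /acc_ptP xp; apply/ler_addgt0Pr => e /(xp _ 0%N)[k _ xk].
  have := ler_distD (x k) p 0; rewrite !subr0 [`|p - x k|]distrC.
  by have := xB k; lra.
have cS : compact S.
  apply: bounded_closed_compact.
    exists B; split; first exact: num_real.
    move=> M BM y; rewrite SC => -[/accB yB _] /=; exact: le_trans yB (ltW BM).
  by rewrite SC; apply: closedI => //; exact: closed_acc_pt.
(* The compact set [S] lies in the open set [V], hence at positive distance from its complement. *)
have [e [e0 gap]] : exists e : R, 0 < e /\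
    forall s q, S s -> ~ V q -> e <= `|s - q|.
  have gap_aux (u r A E F : R) : u < r / 2 -> A < r / 2 -> r <= F -> F <= A + E -> u <= E.
    by lra.
  move: cS => /compact_near_coveringP cS.
  have := cS R 0^'+ (fun e s => forall q, ~ V q -> e <= `|s - q|) _.
  case=> [s|U U0 UP].
    rewrite SV => -[_ Vs].
    have : nbhs s V by exact: open_nbhs_nbhs.
    move=> /nbhs_ballP[r /= r0]; rewrite -ball_normE => rV_.
    near=> s' e => q nVq.
    have er : e < r / 2 by near: e; apply: nbhs_right_lt; rewrite divr_gt0.
    have sr : `|s - s'| < r / 2.
      near: s'; apply: cvgr_dist_lt; first exact: cvg_id.
      by rewrite divr_gt0.
    have rq : r <= `|s - q| by rewrite leNgt; apply/negP => /rV_.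
    exact: gap_aux er sr rq (ler_distD s' s q).
  have [e [e0 He]] := filter_ex (filterI (nbhs_right_gt (0 : R)) (ex_intro2 _ _ U U0 UP)).
  by exists e; split=> // s q Ss; exact: (He s Ss).
have e3 : 0 < e / 3 by rewrite divr_gt0.
have [N _ HN] : \forall k \near \oo, (exists2 q, acc_pt x q & `|x k - q| < e / 3) /\
    `|x k.+1 - x k| < e / 3.
  by apply: filterI; [exact: bounded_near_acc_pt xB e3|exact: steps].
have [k0 Nk0 xk0] : exists2 k, (N <= k)%N & `|x k - b| < e / 3.
  by move: Sb; rewrite SV => -[/acc_ptP xb _]; exact: xb.
(* Being within [e / 3] of [S] propagates: a jump to an accumulation point outside [V] would bridge
   the gap with three distances below [e / 3]. *)
have stay k : exists2 s, S s & `|x (k0 + k)%N - s| < e / 3.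
  elim: k => [|k [s Ss xs]]; first by exists b => //; rewrite addn0.
  have [_ st] := HN (k0 + k)%N (leq_trans Nk0 (leq_addr _ _)).
  have [[q xq kq] _] := HN (k0 + k.+1)%N (leq_trans Nk0 (leq_addr _ _)).
  exists q => //; rewrite SV; split=> //; apply: contrapT => nVq.
  have g := gap s q Ss nVq; rewrite addnS in kq.
  have t1 := ler_distD (x (k0 + k)%N) s q; have t2 := ler_distD (x (k0 + k).+1) (x (k0 + k)%N) q.
  rewrite [`|s - x _|]distrC in t1; rewrite [`|x (k0 + k)%N - x _|]distrC in t2.
  move: st xs kq g t1 t2; clear; lra.
apply/seteqP; split=> [p|p xp]; first by rewrite SV => -[].
rewrite SV; split=> //; apply: contrapT => nVp.
have /acc_ptP/(_ (e / 3) k0 e3)[k kk xk] := xp.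
have [s Ss] := stay (k - k0)%N; rewrite subnKC// => xs.
have g := gap s p Ss nVp; have t := ler_distD (x k) s p; rewrite [`|s - x k|]distrC in t.
move: g t xs xk e0; clear; lra.
Unshelve. all: by end_near. Qed.

Lemma unique_acc_pt_cvg x p (B : R) : (forall k, `|x k| <= B) ->
  (forall q, acc_pt x q -> q = p) -> x @ \oo --> p.
Proof.
move=> xB uniq; apply/cvgrPdist_lt => e e0.
apply: filterS (bounded_near_acc_pt xB e0) => k [q /uniq -> xk].
by rewrite distrC.
Qed.

(** Isolation makes the singleton of [p] relatively open; it is also closed, so by connectedness it
    is the whole set. *)
Lemma isolated_acc_pt_unique x p : connected (acc_pt x) -> isolated_acc_pt x p ->
  forall q, acc_pt x q -> q = p.
Proof.
move=> conn [xp [r [r0 iso]]].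
(* A sup-norm ball of this radius lies in the Euclidean ball of radius [r]; [n.+1] avoids dividing
   by zero. *)
pose s := r / n.+1%:R; have sp : 0 < s by rewrite divr_gt0.
have near_p q : acc_pt x q -> `|p - q| < s -> q = p.
  move=> xq pq; apply: iso => //; apply: le_lt_trans (enorm_le_norm _) _.
  move: pq; rewrite /s ltr_pdivlMr// distrC mulrC; apply: le_lt_trans.
  by rewrite ler_wpM2r// ler_nat leqnSn.
suff <- : [set p] = acc_pt x by [].
apply: conn; first by exists p.
  exists (ball p s); first exact: ball_open.
  apply/seteqP; split=> [_ ->|q [xq]]; first by split=> //; exact: ballxx.
  by rewrite -ball_normE => /= /(near_p q xq).
exists [set p]; first exact/accessible_closed_set1/hausdorff_accessible/norm_hausdorff.
by apply/seteqP; split=> [_ ->|q []].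
Qed.

End AccumulationPoints.

(** * Assembly of the convergence theorem *)

Unset Implicit Arguments.

Theorem theorem4p5 (R : realType) (n : nat) (phi : 'rV[R]_n -> R)
    (tau_min sigma beta : R) :
  upper_C2 phi ->
  (exists lb : R, forall z, lb <= phi z) ->
  0 < tau_min -> 0 < sigma < 1 -> 0 < beta < 1 ->
  (* well-definedness: the backtracking line search always terminates *)
  (forall (z w d : 'rV[R]_n) (tb refv : R),
     clarke_subdiff phi z w -> dotp w d < 0 -> tau_min <= tb -> phi z <= refv ->
     exists i : nat, armijo phi refv sigma z w d (beta ^+ i * tb)) /\
  (* behaviour of every non-stopping run *)
  (forall (x w d : nat -> 'rV[R]_n) (taubar tau : nat -> R) (m : nat -> nat),
    nsm_run phi tau_min sigma beta x w d taubar tau m ->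
    (* (a) *)
    (exists a : R, 0 < a /\ forall k, dotp (w k) (d k) <= - a * enorm (d k) ^+ 2) ->
    (* (b) *)
    (forall kj : nat -> nat, strictly_incr kj -> bounded_seq (x \o kj) ->
       exists b : R, 0 < b /\ forall j, enorm (w (kj j)) <= b * enorm (d (kj j))) ->
    (* (c) *)
    (exists mm : nat, forall k, (m k.+1 <= minn (m k).+1 mm)%N) ->
    (* sup tau_k < +oo *)
    (exists M : R, forall k, tau k <= M) ->
    (* (i) *)
    (forall kj : nat -> nat, strictly_incr kj -> bounded_seq (x \o kj) ->
       (exists c : R, 0 < c /\ forall j, c <= tau (kj j)) /\
       (fun j => enorm (x (kj j).+1 - x (kj j))) @ \oo --> (0 : R) /\
       (fun j => enorm (w (kj j))) @ \oo --> (0 : R) /\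
       (fun j => enorm (d (kj j))) @ \oo --> (0 : R) /\
       exists L : R, (fun k => phi (x (ell phi x m k))) @ \oo --> L /\
                     (fun j => phi (x (kj j))) @ \oo --> L) /\
    (* (ii) *)
    (bounded_seq x ->
       (exists p, acc_pt x p) /\ closed (acc_pt x) /\ connected (acc_pt x) /\
       exists c : R, 0 < c /\ forall k : nat,
         \big[Num.min/(enorm (x 1%N - x 0%N) + enorm (w 0%N) + enorm (d 0%N))]_(j < k.+1)
            (enorm (x j.+1 - x j) + enorm (w j) + enorm (d j))
         <= c / Num.sqrt (k.+1)%:R) /\
    (* (iii) *)
    (forall p, acc_pt x p -> stationary phi p) /\
    (* (iv) *)
    (bounded_seq x -> (exists p, isolated_acc_pt x p) ->
       exists p, x @ \oo --> p /\ stationary phi p)).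
Proof.
move=> u2 [lb phi_lb] tm0 s01 b01; split.
  by move=> z w d tb refv cw wd tmb zr; exact: (armijo_terminates u2 tm0 s01 b01 cw wd tmb zr).
move=> x w d taubar tau m run [a [a0 dd]] wd [mm mem] [T tauT].
have b_norm kj : bounded_seq (x \o kj) -> exists B : R, forall j, `|x (kj j)| <= B.
  by move=> [B hB]; exists B => j; exact: le_trans (norm_le_enorm _) (hB j).
have dir0 := direction_cvg0 u2 phi_lb tm0 s01 b01 run a0 dd mem tauT.
have dist k : enorm (x k.+1 - x k) <= T * enorm (d k).
  rewrite (run_next run) addrC addKr enormZ ?(ltW (run_tau_gt0 tm0 b01 run k))//.
  by rewrite ler_wpM2r ?enorm_ge0 ?tauT.
have T0 : 0 < T by exact: lt_le_trans (run_tau_gt0 tm0 b01 run 0%N) (tauT 0%N).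
(* Proved for all bounded subsequences first: the other claims use it for convergent subsequences
   and, with [id], for the whole sequence. *)
have limits (kj : nat -> nat) : strictly_incr kj -> bounded_seq (x \o kj) ->
    (exists c : R, 0 < c /\ forall j, c <= tau (kj j)) /\
    (fun j => enorm (x (kj j).+1 - x (kj j))) @ \oo --> (0 : R) /\
    (fun j => enorm (w (kj j))) @ \oo --> (0 : R) /\
    (fun j => enorm (d (kj j))) @ \oo --> (0 : R) /\
    exists L : R, (fun k => phi (x (ell phi x m k))) @ \oo --> L /\
                  (fun j => phi (x (kj j))) @ \oo --> L.
  move=> kji bdd; have [B xB] := b_norm _ bdd.
  have [b [b0 wb]] := wd kj kji bdd.
  (* Steps, subgradients and directions are all bounded by multiples of [enorm (d (kj j))]. *)
  have small (C : R) (u : nat -> 'rV[R]_n) : 0 < C ->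
      (forall j, enorm (u j) <= C * enorm (d (kj j))) ->
      (fun j => enorm (u j)) @ \oo --> (0 : R).
    move=> C0 uC; apply/cvgrPdist_le => eps eps0.
    have := near_subseq kji (dir0 B (eps / C) (divr_gt0 eps0 C0)).
    apply: filterS => j /(_ (xB j)); rewrite ler_pdivlMr// mulrC => h.
    by rewrite sub0r normrN ger0_norm ?enorm_ge0// (le_trans (uC j)).
  split.
    have [c [c0 hc]] := stepsize_bounded_below u2 phi_lb tm0 s01 b01 run a0 dd mem B.
    by exists c; split=> // j; exact: hc.
  split; first exact: (small T).
  split; first exact: (small b).
  split; first by apply: (small 1) => // j; rewrite mul1r.
  have [L [ML LM]] := maxref_cvg phi_lb tm0 s01 b01 run a0 dd mem.
  exists L; split.
    by rewrite (_ : (fun k => _) = maxref phi x m)//; apply/funext => k; exact: phi_ell.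
  apply/cvgrPdist_le => eps eps0.
  have := near_subseq kji (value_limit u2 phi_lb tm0 s01 b01 run a0 dd mem tauT B ML LM eps0).
  by apply: filterS => j /(_ (xB j)); rewrite distrC.
have acc_stationary p : acc_pt x p -> stationary phi p.
  move=> [kj [kji xp]].
  have bdd : bounded_seq (x \o kj).
    have [B [_ hB]] := cvg_seq_bounded (cvgP _ xp).
    exists (n%:R * (B + 1)) => j; apply: le_trans (enorm_le_norm _) _.
    by rewrite ler_wpM2l//; apply: hB => //; rewrite ltrDl.
  have [_ [_ [w0 _]]] := limits kj kji bdd.
  apply: (clarke_subdiff_closed (fun j => run_clarke run (kj j)) xp).
  apply/cvgrPdist_lt => e e0; move/cvgrPdist_lt: w0 => /(_ e e0).
  apply: filterS => j; rewrite !sub0r !normrN ger0_norm ?enorm_ge0//.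
  exact: le_lt_trans (norm_le_enorm _).
have conn : bounded_seq x -> connected (acc_pt x).
  move=> bdd; have [B xB] := b_norm id bdd.
  apply: (connected_acc_pt xB) => e e0.
  have [_ [/cvgrPdist_lt/(_ e e0) st _]] := limits id (fun j => ltnSn j) bdd.
  apply: filterS st => k; rewrite sub0r normrN ger0_norm ?enorm_ge0//.
  exact: le_lt_trans (norm_le_enorm _).
split=> //; split; last split=> //.
  move=> bdd; have [B xB] := b_norm id bdd.
  split; first exact: bounded_acc_pt_ex xB.
  split; first exact: closed_acc_pt.
  split; first exact: conn.
  have [b [b0 wb]] := wd id (fun j => ltnSn j) bdd.
  have [c [c0 hc]] := stepsize_bounded_below u2 phi_lb tm0 s01 b01 run a0 dd mem B.
  have [C [C0 rate]] := direction_rate phi_lb tm0 s01 b01 run a0 dd mem c0 (fun k => hc k (xB k)).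
  (* The three summands bound the step, the subgradient and the direction relative to
     [enorm (d j)]. *)
  pose K := T + b + 1; have K0 : 0 < K by rewrite /K; lra.
  exists (K * Num.sqrt C); split; first by rewrite mulr_gt0 ?sqrtr_gt0.
  move=> k; set q := \big[Num.min/_]_(j < k.+1) _.
  have resid j : enorm (x j.+1 - x j) + enorm (w j) + enorm (d j) <= K * enorm (d j).
    by have := dist j; have := wb j; rewrite /K /=; lra.
  have q0 : 0 <= q.
    by apply: le_bigmin => [|j _]; rewrite !addr_ge0 ?enorm_ge0.
  (* The minimal residual divided by [K] is a lower bound for all directions up to [k], so its
     square can be inserted in [rate]. *)
  have qd j : (j <= k)%N -> q / K <= enorm (d j).
    rewrite -ltnS => jk; rewrite ler_pdivrMr// mulrC; apply: le_trans (resid j).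
    exact: (bigmin_le_cond _ (j := Ordinal jk)).
  have qK : 0 <= q / K by rewrite divr_ge0// ltW.
  have h : (q / K) ^+ 2 * k.+1%:R <= C.
    apply: rate => [|j jk]; first exact: sqr_ge0.
    by rewrite lerXn2r ?nnegrE ?enorm_ge0//; exact: qd.
  rewrite ler_pdivlMr ?sqrtr_gt0// -ler_pdivrMl// mulrA [K^-1 * q]mulrC.
  rewrite -[q / K]ger0_norm// -sqrtr_sqr -sqrtrM ?sqr_ge0//.
  by rewrite ler_sqrt// ltW.
move=> bdd [p isop]; have [B xB] := b_norm id bdd; exists p; split.
  exact: unique_acc_pt_cvg xB (isolated_acc_pt_unique (conn bdd) isop).
by apply: acc_stationary; case: isop.
Qed.
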